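(* Let $G$ be a finite group and $p$ an odd prime, and suppose that $G$ has $C_p$ as an epimorphic image (in other words, $p$ divides $|G/G'|$). Then $\alpha(G)\le 2/p$, with equality if and only if $G$ is a direct product of an elementary abelian $2$-group with a Frobenius group whose Frobenius kernel is an elementary abelian $2$-group and whose Frobenius complements have order $p$.
   Context: For a finite group $H$, $c(H)$ denotes the number of cyclic subgroups of $H$ (including the trivial one) and $\alpha(H):=c(H)/|H|$. $C_p$ is the cyclic group of order $p$ and $G'$ is the derived subgroup of $G$. Frobenius group, Frobenius kernel and Frobenius complement have their usual meaning.
   Formalization: In the equality case the Frobenius group is also allowed to have trivial kernel, i.e. to be just C_p (otherwise G = C_p is a counterexample), and the parenthetical restatement ''p divides |G/G'|'' is not stated separately. *)

(* Defs.v *)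
From mathcomp Require Import all_boot all_order all_algebra all_fingroup.
From mathcomp Require Import all_solvable.

Set Implicit Arguments.
Unset Strict Implicit.
Unset Printing Implicit Defensive.

Import GroupScope GRing.Theory.

Definition num_cyclic (gT : finGroupType) (G : {set gT}) : nat :=
  #|[set C : {group gT} | (C \subset G) && cyclic C]|.

Definition alpha (gT : finGroupType) (G : {set gT}) : rat :=
  ((num_cyclic G)%:R / #|G|%:R)%R.

(* [Frobenius F = K ><| H] forces K != 1.  The degenerate case K = 1, H = F is
   added because a cyclic group F of order p, read as the Frobenius group with
   trivial kernel and complement F, does attain alpha F = 2 / p. *)
Definition Frobenius_with_possibly_trivial_kernel (gT : finGroupType)
    (F K H : {set gT}) : Prop :=
  [Frobenius F = K ><| H] \/ K = 1 /\ H = F.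

(* Main.v *)
Require Import Defs.
From mathcomp Require Import all_boot all_order all_algebra all_fingroup.
From mathcomp Require Import all_solvable.

Set Implicit Arguments.
Unset Strict Implicit.
Unset Printing Implicit Defensive.

Import GroupScope GRing.Theory Num.Theory.

(** Let N be a normal subgroup of index p in G.  The cyclic subgroups of G are
counted according to whether they lie in N.

Those inside N number at most |N|, since x |-> <[x]> maps N onto them; equality
forces x and x^-1, which generate the same subgroup, to coincide for all x in
N, so it holds exactly when N is an elementary abelian 2-group
([num_cyclic_leqif]).

A cyclic subgroup C of G outside N has order divisible by p
([prime_dvd_order]), hence at least p - 1 generators
([leq_totient_prime_dvd]).  These generators lie in G \ N, a set of (p - 1)|N|
elements, and different subgroups have disjoint sets of generators; so there
are at most |N| such subgroups.  If N is an elementary abelian 2-group then C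
has order p or 2p, hence exactly p - 1 generators because p is odd
([totient_order_abelem2]), and the bound is attained.

Altogether G has at most 2|N| cyclic subgroups, that is alpha G <= 2 / p, with
equality if and only if N is an elementary abelian 2-group
([alpha_leqif_index]).  It remains to see what this means for the structure of
G.  When it holds, N has a complement P of order p, and coprime action splits N
as [N, P] x C_N(P): the second factor is central in G, while P acts without
nontrivial fixed points on the first, so that [N, P] P is a Frobenius group or
is just P ([abelem2_sdprod_prime_decomposition]).  Conversely, if
G = E x (K ><| H) is of the required form, then E x K is a normal elementary
abelian 2-subgroup of index p, and the equality case applies to it. *)

(** If p ^ k is the exact power of p dividing n, with cofactor m, then
    totient n = (p - 1) p ^ (k - 1) totient m. *)
Lemma leq_totient_prime_dvd (p n : nat) :
  prime p -> 0 < n -> p %| n -> p.-1 <= totient n.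
Proof.
move=> p_pr n_gt0 p_n; have [m co_pm def_n] := pfactor_coprime p_pr n_gt0.
have logn_gt0 : 0 < logn p n by rewrite logn_gt0 mem_primes p_pr n_gt0.
have m_gt0 : 0 < m by move: n_gt0; rewrite {1}def_n muln_gt0 => /andP[].
rewrite def_n totient_coprime; last by rewrite coprime_sym coprimeXl.
rewrite totient_pfactor // mulnCA leq_pmulr // muln_gt0 totient_gt0 m_gt0 /=.
by rewrite expn_gt0 prime_gt0.
Qed.

Lemma card_cyclic_generators (gT : finGroupType) (C : {group gT}) :
  cyclic C -> #|[set x | C == <[x]>%G]| = totient #|C|.
Proof.
case/cyclicP=> a defC; rewrite defC (totient_gen a); apply: eq_card => x.
by rewrite !inE /generator -val_eqE /= defC.
Qed.

(** The map x |-> <[x]> from G to its cyclic subgroups is onto.  If it is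
    injective then x = x^-1 for all x, and groups of exponent 2 are abelian;
    conversely, a subgroup of order at most 2 has a single generator. *)
Lemma num_cyclic_leqif (gT : finGroupType) (G : {group gT}) :
  num_cyclic G <= #|G| ?= iff 2.-abelem G.
Proof.
have -> : num_cyclic G = #|[set <[x]>%G | x in G]|.
  apply: eq_card => C; rewrite inE.
  apply/andP/imsetP => [[sCG /cyclicP[x defC]] | [x Gx ->]].
    by exists x; [rewrite -cycle_subG -defC | apply: val_inj].
  by rewrite cycle_subG Gx cycle_cyclic.
split; first exact: leq_imset_card.
apply/imset_injP/idP => [injG | abelG x y Gx Gy eqxy].
  apply: exponent2_abelem; apply/exponentP=> x Gx.
  have /injG: <[x]>%G = <[x^-1]>%G by apply: val_inj; rewrite /= cycleV.
  by rewrite groupV => /(_ Gx Gx) xV; rewrite expgS expg1 {2}xV mulgV.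
have defxy : <[x]> = <[y]> by case: eqxy.
have [x1 | ntx] := eqVneq x 1.
  by apply/eqP; rewrite x1 eq_sym -cycle_eq1 -defxy x1 cycle1.
have : x \in <[y]> by rewrite -defxy cycle_id.
rewrite cycle2g; first by rewrite !inE (negPf ntx) => /eqP.
by apply: (abelem_order_p abelG) => //; rewrite -cycle_eq1 -defxy cycle_eq1.
Qed.

(** The image of x in G / N is a nontrivial element of a group of order p, and
    its order divides that of x. *)
Lemma prime_dvd_order (gT : finGroupType) (G N : {group gT}) (p : nat) x :
  prime p -> N <| G -> #|G : N| = p -> x \in G :\: N -> p %| #[x].
Proof.
move=> p_pr nNG iGN /setDP[Gx N'x].
have Nx : x \in 'N(N) by apply: (subsetP (normal_norm nNG)).
apply: dvdn_trans (morph_order (coset_morphism N) Nx).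
have: #[coset N x] %| p.
  by rewrite -iGN -card_quotient ?normal_norm // order_dvdG // mem_quotient.
case/primeP: p_pr => _ p_pr /p_pr /orP[]; last by move/eqP->.
by rewrite order_eq1 => /eqP/(coset_idr Nx) Nx'; rewrite Nx' in N'x.
Qed.

(** Since x ^+ p lies in N, its square is trivial; so x has order p or 2p,
    and totient 2 = 1. *)
Lemma totient_order_abelem2 (gT : finGroupType) (G N : {group gT}) (p : nat)
    x :
  prime p -> odd p -> N <| G -> #|G : N| = p -> 2.-abelem N ->
  x \in G :\: N -> totient #[x] = p.-1.
Proof.
move=> p_pr p_odd nNG iGN abelN GNx.
have p_x := prime_dvd_order p_pr nNG iGN GNx.
have [Gx _] := setDP GNx.
have Nx : x \in 'N(N) by apply: (subsetP (normal_norm nNG)).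
have Nxp : x ^+ p \in N.
  apply: coset_idr; first exact: groupX.
  rewrite morphX //; apply/eqP; rewrite -order_dvdn -iGN.
  by rewrite -card_quotient ?normal_norm // order_dvdG // mem_quotient.
have : #[x] %| p * 2.
  rewrite order_dvdn expgM; case/(abelemP (isT : prime 2)): abelN => _.
  by move/(_ _ Nxp) ->.
have [k ->] := dvdnP p_x; rewrite mulnC dvdn_pmul2l ?prime_gt0 //.
case/primeP: (isT : prime 2) => _ pr2 /pr2 /orP[] /eqP ->.
  by rewrite muln1 totient_prime.
by rewrite totient_coprime ?coprimen2 // totient_prime // muln1.
Qed.

(** The bound is |N| + |N|: the first term bounds the number of cyclic subgroups
    inside N, the second the number of those outside, found by sorting the
    (p - 1)|N| elements of G \ N according to the subgroup they generate. *)
Lemma num_cyclic_index_leqif (gT : finGroupType) (G N : {group gT}) (p : nat) :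
  prime p -> odd p -> N <| G -> #|G : N| = p ->
  num_cyclic G <= 2 * #|N| ?= iff 2.-abelem N.
Proof.
move=> p_pr p_odd nNG iGN; have sNG := normal_sub nNG.
set B := [set C : {group gT} | [&& C \subset G, cyclic C & ~~ (C \subset N)]].
have defc : num_cyclic G = num_cyclic N + #|B|.
  rewrite /num_cyclic -(cardsID [set C : {group gT} | C \subset N]).
  congr (_ + _); apply: eq_card => C; rewrite !inE.
    have [sCN | //] := boolP (C \subset N); rewrite ?andbT ?andbF //.
    by rewrite (subset_trans sCN).
  by rewrite andbC andbA.
have p1_gt0 : 0 < p.-1 by rewrite -subn1 subn_gt0 prime_gt1.
have cardGN : #|G :\: N| = (p.-1 * #|N|)%N.
  rewrite cardsD (setIidPr sNG) -(Lagrange sNG) iGN.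
  by rewrite -subn1 mulnBl mul1n mulnC.
have sumB : #|G :\: N| = \sum_(C in B) totient #|C|.
  rewrite -sum1_card.
  rewrite (partition_big (fun x => <[x]>%G) (mem B)) /=; last first.
    by move=> x /setDP[Gx N'x]; rewrite inE !cycle_subG Gx N'x cycle_cyclic.
  apply: eq_bigr => C; rewrite inE => /and3P[sCG cycC N'C].
  rewrite sum1_card -card_cyclic_generators //; apply: eq_card => x.
  rewrite !inE unfold_in /= eq_sym andbC; case: eqP => //= defC.
  by rewrite !inE -!cycle_subG -[<[x]>]/(gval <[x]>%G) -defC sCG N'C.
have Bgen C : C \in B -> exists2 x, x \in G :\: N & C :=: <[x]>.
  rewrite inE => /and3P[sCG /cyclicP[x defC] N'C]; exists x => //.
  by rewrite inE -!cycle_subG -defC N'C.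
have leB : p.-1 * #|B| <= p.-1 * #|N|.
  rewrite -cardGN sumB mulnC -sum_nat_const.
  apply: leq_sum => C /Bgen[x GNx ->].
  by rewrite leq_totient_prime_dvd ?order_gt0 ?(prime_dvd_order p_pr nNG iGN).
have [leN eqN] := num_cyclic_leqif N.
rewrite leq_pmul2l // in leB.
rewrite defc mul2n -addnn; split; first exact: leq_add.
apply/eqP/idP => [eqc | abelN].
  (* Equality of the sums forces equality in the first term, as the second one
     is at most |N|. *)
  by rewrite -eqN eqn_leq leN -(leq_add2r #|B|) eqc leq_add2l.
congr (_ + _); first by apply/eqP; rewrite eqN.
apply/eqP; rewrite -(eqn_pmul2l p1_gt0) -cardGN sumB mulnC -sum_nat_const.
apply/eqP/eq_bigr => C /Bgen[x GNx ->].
by rewrite [RHS](totient_order_abelem2 p_pr p_odd nNG iGN abelN GNx).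
Qed.

Lemma alpha_leqif_index (gT : finGroupType) (G N : {group gT}) (p : nat) :
  prime p -> odd p -> N <| G -> #|G : N| = p ->
  (alpha G <= 2%:R / p%:R ?= iff 2.-abelem N)%R.
Proof.
move=> p_pr p_odd nNG iGN.
have [leG eqG] := num_cyclic_index_leqif p_pr p_odd nNG iGN.
have N_gt0 : (0 < #|N|%:R :> rat)%R by rewrite ltr0n.
have p_gt0 : (0 < p%:R :> rat)%R by rewrite ltr0n prime_gt0.
have -> : alpha G = ((num_cyclic G)%:R / #|N|%:R / p%:R)%R.
  by rewrite /alpha -(Lagrange (normal_sub nNG)) iGN natrM invfM mulrA.
split.
  by rewrite ler_pM2r ?invr_gt0 // ler_pdivrMr // -natrM ler_nat.
rewrite (inj_eq (mulIf _)) ?invr_eq0 ?lt0r_neq0 //.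
by rewrite -[X in _ == X]divr1 eqr_div ?lt0r_neq0 // mulr1 -natrM eqr_nat.
Qed.

(** A acts trivially on G / [G, A], and fixed points of a coprime action lift
    from a quotient, so C_G(A) covers G / [G, A]. *)
Lemma coprime_commg_cent_prod (gT : finGroupType) (A G : {group gT}) :
  A \subset 'N(G) -> coprime #|G| #|A| -> solvable G ->
  [~: G, A] * 'C_G(A) = G.
Proof.
move=> nGA coGA solG; have sRG : [~: G, A] \subset G by rewrite commg_subl.
apply/eqP; rewrite eqEsubset mulG_subG sRG subsetIl /=.
rewrite -quotientSK ?commg_norml //.
rewrite coprime_quotient_cent ?commg_normr // subsetI subxx /=.
by rewrite quotient_cents2r.
Qed.

(** Take E = C_N(P) and K = [N, P].  Then K ><| P is Frobenius unless K = 1: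
    as P has prime order, each of its nontrivial elements has the same fixed
    points in K as P itself, namely none but 1. *)
Lemma abelem2_sdprod_prime_decomposition (gT : finGroupType)
    (G N P : {group gT}) (p : nat) :
  prime p -> odd p -> N ><| P = G -> #|P| = p -> 2.-abelem N ->
  exists E F K : {group gT},
    [/\ E \x F = G, 2.-abelem E,
        Frobenius_with_possibly_trivial_kernel F K P & 2.-abelem K].
Proof.
move=> p_pr p_odd defG oP abelN.
have [_ defNP nNP tiNP] := sdprodP defG.
have abN := abelem_abelian abelN.
have coNP : coprime #|N| #|P|.
  rewrite oP (pnat_coprime (abelem_pgroup abelN)) // p'natE //.
  by rewrite dvdn_prime2 //; case: eqP p_odd => // <-.
have defN : [~: N, P] * 'C_N(P) = N
  := coprime_commg_cent_prod nNP coNP (abelian_sol abN).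
have tiKP := coprime_abel_cent_TI nNP coNP abN.
have sKN : [~: N, P] \subset N by rewrite commg_subl.
have nKP : P \subset 'N([~: N, P]) by rewrite commg_normr.
have defF : [~: N, P] ><| P = [~: N, P] <*> P.
  by rewrite sdprodEY //; apply/trivgP; rewrite -tiNP setSI.
have cCK : 'C_N(P) \subset 'C([~: N, P]).
  exact: subset_trans (subsetIl _ _) (subset_trans abN (centS sKN)).
exists 'C_N(P)%G, ([~: N, P] <*> P)%G, [~: N, P]%G; split.
- rewrite /= dprodEY.
  + rewrite joingA [_ <*> [~: N, P]]joingC.
    by rewrite (cent_joinEr (G := [~: N, P]%G)) // defN -(sdprodEY nNP tiNP).
  + by rewrite join_subG centsC cCK centsC subsetIr.
  (* By Dedekind's law an element of N lying in K P already lies in K, where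
     the only fixed point of P is 1. *)
  have defFN : ([~: N, P] <*> P) :&: N = [~: N, P].
    by rewrite -(sdprod_modl defF sKN) setIC tiNP sdprodg1.
  apply/trivgP; rewrite -tiKP; apply/subsetP=> x /setIP[/setIP[Nx Cx] Fx].
  by rewrite inE Cx -defFN inE Fx Nx.
- exact: abelemS (subsetIl _ _) abelN.
- have [K1 | ntK] := eqVneq [~: N, P] 1; [right | left].
    by rewrite /= K1 joing1G.
  have ntP : P != 1 :> {set gT} by rewrite -cardG_gt1 oP prime_gt1.
  apply/Frobenius_semiregularP => //.
  apply: semiprime_regular => // x /setD1P[ntx Px].
  suffices -> : P :=: <[x]> by rewrite cent_cycle.
  apply/eqP; rewrite eq_sym eqEcard cycle_subG Px -orderE oP.
  have ox : #[x] %| p by rewrite -oP order_dvdG.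
  suffices -> : #[x] = p by rewrite leqnn.
  by apply/prime_nt_dvdP; rewrite ?order_eq1.
exact: abelemS sKN abelN.
Qed.

Lemma homg_Zp_normal_index (gT : finGroupType) (G : {group gT}) (n : nat) :
  0 < n -> Zp n \homg G -> exists2 N : {group gT}, N <| G & #|G : N| = n.
Proof.
move=> n_gt0 /homgP[f im_f]; exists ('ker f)%G; first exact: ker_normal.
rewrite -card_quotient ?normal_norm ?ker_normal // (card_isog (first_isog f)).
exact: etrans (congr1 (fun A : {set 'Z_n} => #|A|) im_f) (card_Zp n_gt0).
Qed.

Theorem proposition2 (gT : finGroupType) (G : {group gT}) (p : nat)
    (p_prime : prime p) (p_odd : odd p) (Cp_image : Zp p \homg G) :
  (alpha G <= 2%:R / p%:R)%R /\
  (alpha G = (2%:R / p%:R)%R <->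
   exists E F K H : {group gT},
     [/\ E \x F = G, 2.-abelem E,
         Frobenius_with_possibly_trivial_kernel F K H,
         2.-abelem K & #|H| = p]).
Proof.
have [N nNG iNG] := homg_Zp_normal_index (prime_gt0 p_prime) Cp_image.
have [le_alpha eq_alpha] := alpha_leqif_index p_prime p_odd nNG iNG.
split=> //; split=> [/eqP | [E [F [K [H [defG abelE FrobF abelK oH]]]]]].
  rewrite eq_alpha => abelN.
  have coN : coprime #|N| #|G : N|.
    rewrite iNG (pnat_coprime (abelem_pgroup abelN)) // p'natE //.
    by rewrite dvdn_prime2 //; case: eqP p_odd => // <-.
  have hallN : Hall G N by rewrite /Hall normal_sub.
  have /splitsP[P complP] := SchurZassenhaus_split hallN nNG.
  have defG : N ><| P = G.
    by apply/(sdprod_normal_complP nNG); rewrite complgC.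
  have oP : #|P| = p.
    apply/eqP; rewrite -(eqn_pmul2l (cardG_gt0 N)) -iNG.
    by rewrite (sdprod_card defG) Lagrange ?normal_sub.
  have [E [F [K dec]]] :=
    abelem2_sdprod_prime_decomposition p_prime p_odd defG oP abelN.
  by case: dec => *; exists E, F, K, P; split.
have defF : K ><| H = F.
  by case: FrobF => [/Frobenius_context[] // | [-> ->]]; rewrite sdprod1g.
have [nKF sHF _ _ _] := sdprod_context defF.
have sKF := normal_sub nKF.
have [_ defEF cEF tiEF] := dprodP defG.
have defN : E \x K = E <*> K.
  rewrite dprodEY ?(subset_trans sKF) //.
  by apply/trivgP; rewrite -tiEF setIS.
have abelN : 2.-abelem (E <*> K) by rewrite (dprod_abelem 2 defN) abelE.
have nNG' : E <*> K <| G.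
  have [nEG _] := dprod_normal2 defG; rewrite normalY //.
  rewrite /normal (subset_trans sKF) -defEF ?mulG_subr //.
  rewrite mulG_subG (normal_norm nKF) andbT cents_norm // centsC.
  exact: subset_trans cEF.
have iNG' : #|G : E <*> K| = p.
  apply/eqP; rewrite -(eqn_pmul2l (cardG_gt0 (E <*> K)%G)).
  rewrite Lagrange ?normal_sub // -(dprod_card defN) -(dprod_card defG).
  by rewrite -(sdprod_card defF) oH mulnA.
(* The equality criterion holds for every normal subgroup of index p, so E K may
   take the place of the kernel N chosen above. *)
apply/eqP; have [_ ->] := alpha_leqif_index p_prime p_odd nNG' iNG'.
exact: abelN.
Qed.
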